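(* Let $p=2$ and let $r\in I$ with $r\neq|a-d|_2$. Then the dynamical system $(S_r(0),f,\mu)$ is ergodic if and only if one of the following conditions occurs: (1) $|a|_2<\beta$, $|d|_2=\beta$ and $r=\dfrac{\alpha}{2}$. (2) $|a|_2=\beta$ and $r=\dfrac{\beta}{2}$. (3) $|a|_2>\beta$ and $r=\dfrac{\alpha\beta}{2|a|_2}$.
   Context: The dynamical system is considered over $\mathbb Q_2$ with norm $|\cdot|_2$. Let $a,b,d\in\mathbb Q_2$ with $ab\ne0$, $a\neq d$, and $$f(x)=\frac{ax^2+bx}{x^2+dx+b}.$$ It is assumed that $\sqrt{d^2-4b}$ exists in $\mathbb Q_2$, so the roots $\hat x_1,\hat x_2$ of $x^2+dx+b$ lie in $\mathbb Q_2$. Put $\alpha=|\hat x_1|_2$, $\beta=|\hat x_2|_2$, labelled so that $\alpha\le\beta$. Standing assumption: $f$ has the two distinct fixed points $0$ and $a-d$ (in particular $a-d$ is not a root of the denominator, i.e. $b+a(a-d)\ne0$). $S_r(0)=\{x\in\mathbb Q_2:|x|_2=r\}$, where $r$ is a value of the norm (a power of $2$ with integer exponent). The set $I$ of radii is: $I=\{r:0<r<\alpha\}$ if $|a|_2<\beta$; $I=\{r:0<r<\alpha\text{ or }\alpha<r<\beta\}$ if $|a|_2=\beta$; $I=\{r:0<r<\alpha\beta/|a|_2\}$ if $|a|_2>\beta$. For $r\in I$ one has $f(S_r(0))\subset S_r(0)$. $\mathcal B$ is the algebra generated by the closed subsets of $S_r(0)$, and $\mu$ is the normalized (probability) Haar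 measure on $S_r(0)$: for a closed ball $V_\rho(c)=\{x\in\mathbb Q_2:|x-c|_2\le\rho\}\subset S_r(0)$ (with $\rho$ a value of the norm), $\mu(V_\rho(c))=\frac{p\rho}{(p-1)r}$ with $p=2$. The map $f$ preserves $\mu$. The system $(S_r(0),f,\mu)$ is ergodic if every invariant set $V\in\mathcal B$ satisfies $\mu(V)=0$ or $\mu(V)=1$. *)

(* Defs.v *)
From HB Require Import structures.
From mathcomp Require Import all_boot all_order all_algebra.
From mathcomp Require Import generic_quotient ring_quotient.
From mathcomp Require Import all_classical all_reals all_analysis.

Set Implicit Arguments.
Unset Strict Implicit.
Unset Printing Implicit Defensive.

Import Order.TTheory GRing.Theory Num.Theory.
Import numFieldNormedType.Exports.

Local Open Scope classical_set_scope.
Local Open Scope ring_scope.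

(* The 2-adic absolute value of a rational number: |2^k m/n|_2 = 2^-k for m, n
   odd. All 2-adic absolute values are rational, so norms and radii live in
   rat. *)
Definition rnorm2 (q : rat) : rat :=
  if q == 0 then 0
  else 2%:Q ^ ((logn 2 `|denq q|%N)%:Z - (logn 2 `|numq q|%N)%:Z).

Lemma rnorm2_ge0 q : 0 <= rnorm2 q.
Proof. by rewrite /rnorm2; case: ifP => // _; apply: exprz_ge0. Qed.

Lemma rnorm2_0 : rnorm2 0 = 0. Proof. by rewrite /rnorm2 eqxx. Qed.

Lemma rnorm2_eq0 q : (rnorm2 q == 0) = (q == 0).
Proof.
rewrite /rnorm2; case: (eqVneq q 0) => [_|q0]; first by rewrite eqxx.
by rewrite expfz_eq0 andbF.
Qed.

Lemma rnorm2_frac (n d : int) : n != 0 -> d != 0 ->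
  rnorm2 (n%:~R / d%:~R) = 2%:Q ^ ((logn 2 `|d|%N)%:Z - (logn 2 `|n|%N)%:Z).
Proof.
move=> n0 d0; set q : rat := n%:~R / d%:~R.
have nQ : n%:~R != 0 :> rat by rewrite intr_eq0.
have dQ : d%:~R != 0 :> rat by rewrite intr_eq0.
have q0 : q != 0 by rewrite mulf_neq0// invr_neq0.
rewrite /rnorm2 (negPf q0); congr (_ ^ _).
have E : numq q * d = n * denq q.
  apply/eqP; rewrite -(eqr_int rat) !intrM.
  by rewrite {1}numqE {1}/q mulrAC divfK.
have := congr1 (fun z : int => logn 2 `|z|%N) E.
rewrite /= !abszM !lognM ?absz_gt0 ?numq_eq0 ?denq_eq0// => /(congr1 Posz).
by rewrite !PoszD => H; apply/eqP; rewrite subr_eq addrAC eq_sym subr_eq addrC H addrC.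
Qed.

Lemma rnorm2M : {morph rnorm2 : x y / x * y}.
Proof.
move=> x y; have [->|x0] := eqVneq x 0; first by rewrite mul0r rnorm2_0 mul0r.
have [->|y0] := eqVneq y 0; first by rewrite mulr0 rnorm2_0 mulr0.
rewrite -{1}[x]divq_num_den -{1}[y]divq_num_den mulf_div -!intrM.
rewrite rnorm2_frac ?mulf_neq0 ?numq_eq0 ?denq_eq0//.
rewrite /rnorm2 (negPf x0) (negPf y0) -expfzDr//; congr (_ ^ _).
by rewrite !abszM !lognM ?absz_gt0 ?numq_eq0 ?denq_eq0// !PoszD opprD addrACA.
Qed.

Lemma rnorm2_1 : rnorm2 1 = 1.
Proof. by have := @rnorm2_frac 1 1 isT isT; rewrite divr1. Qed.

Lemma rnorm2N x : rnorm2 (- x) = rnorm2 x.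
Proof. by rewrite /rnorm2 oppr_eq0 numqN denqN abszN. Qed.

Lemma rnorm2V x : rnorm2 x^-1 = (rnorm2 x)^-1.
Proof.
have [->|x0] := eqVneq x 0; first by rewrite invr0 rnorm2_0.
apply: (@mulIf _ (rnorm2 x)); first by rewrite rnorm2_eq0.
by rewrite -rnorm2M !mulVf ?rnorm2_1 ?rnorm2_eq0.
Qed.

Lemma rnorm2_le1 z : rnorm2 z <= 1 -> rnorm2 (1 + z) <= 1.
Proof.
have [->|z0] := eqVneq z 0; first by rewrite addr0 rnorm2_1.
have [->|z1] := eqVneq (1 + z) 0; first by rewrite rnorm2_0.
move=> zle.
have d0 : logn 2 `|denq z|%N = 0%N.
  move: zle; rewrite /rnorm2 (negPf z0).
  rewrite -[X in _ <= X](expr0z 2%:Q) ler_eXz2l// subr_le0 lez_nat => dn.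
  apply/eqP; rewrite -leqn0 leqNgt; apply/negP => dgt.
  have := coprime_num_den z; rewrite /coprime => /eqP g1.
  have : (2 %| gcdn `|numq z| `|denq z|)%N.
    rewrite dvdn_gcd; apply/andP; split.
      by move: (leq_trans dgt dn); rewrite logn_gt0 mem_primes => /and3P[].
    by move: dgt; rewrite logn_gt0 mem_primes => /and3P[].
  by rewrite g1.
have E : 1 + z = (denq z + numq z)%:~R / (denq z)%:~R.
  by rewrite intrD mulrDl divff ?intr_eq0 ?denq_eq0// divq_num_den.
have n0 : denq z + numq z != 0.
  by apply: contraNneq z1 => n0; rewrite E n0 mul0r.
rewrite E rnorm2_frac ?denq_eq0// d0 -[X in _ <= X](expr0z 2%:Q) ler_eXz2l//.
by rewrite sub0r oppr_le0.
Qed.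

Lemma rnorm2D x y : rnorm2 (x + y) <= Num.max (rnorm2 x) (rnorm2 y).
Proof.
wlog yx : x y / rnorm2 y <= rnorm2 x.
  move=> H; have /orP[yx|xy] := le_total (rnorm2 y) (rnorm2 x); first exact: H.
  by rewrite addrC maxC; exact: H.
rewrite max_l//; have [x0|x0] := eqVneq x 0.
  by move: yx; rewrite x0 add0r rnorm2_0.
have -> : x + y = x * (1 + y / x) by rewrite mulrDr mulr1 mulrCA divff ?mulr1.
rewrite rnorm2M ler_piMr ?rnorm2_ge0// rnorm2_le1// rnorm2M rnorm2V.
by rewrite ler_pdivrMr ?mul1r// lt_neqAle eq_sym rnorm2_eq0 x0 rnorm2_ge0.
Qed.

Lemma rnorm2B x y : rnorm2 (x - y) <= Num.max (rnorm2 x) (rnorm2 y).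
Proof. by rewrite -(rnorm2N y) rnorm2D. Qed.

Definition cauchy2 (u : nat -> rat) : Prop := forall e : rat, 0 < e ->
  exists N, forall m n, (N <= m)%N -> (N <= n)%N -> rnorm2 (u m - u n) < e.

Definition null2 (u : nat -> rat) : Prop := forall e : rat, 0 < e ->
  exists N, forall n, (N <= n)%N -> rnorm2 (u n) < e.

Lemma cauchy2_bounded u : cauchy2 u ->
  exists2 M, 0 < M & forall n, rnorm2 (u n) <= M.
Proof.
move=> /(_ 1 ltr01) [N uN].
pose M := 1 + rnorm2 (u N) + \sum_(i < N) rnorm2 (u i).
have S0 : 0 <= \sum_(i < N) rnorm2 (u i).
  by apply: sumr_ge0 => i _; exact: rnorm2_ge0.
exists M.
  by rewrite /M -addrA ltr_pwDl// addr_ge0// rnorm2_ge0.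
move=> n; have [Nn|nN] := leqP N n.
  have -> : u n = (u n - u N) + u N by rewrite subrK.
  apply: (le_trans (rnorm2D _ _)); rewrite ge_max; apply/andP; split.
    apply: ltW; apply: (lt_le_trans (uN _ _ Nn (leqnn N))).
    by rewrite /M -addrA lerDl addr_ge0// rnorm2_ge0.
  by rewrite /M addrAC lerDr addr_ge0.
rewrite /M (bigD1 (Ordinal nN))//= addrCA lerDl !addr_ge0// ?rnorm2_ge0//.
by apply: sumr_ge0 => i _; exact: rnorm2_ge0.
Qed.

Definition cauchyb : {pred nat -> rat} := fun u => `[< cauchy2 u >].

Lemma cauchy2_subring : subring_closed cauchyb.
Proof.
split.
- apply/asboolP => e e0; exists 0%N => m n _ _.
  by rewrite subrr rnorm2_0.
- move=> u v /asboolP cu /asboolP cv; apply/asboolP => e e0.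
  have [N uN] := cu _ e0; have [N' vN] := cv _ e0.
  exists (maxn N N') => m n; rewrite !geq_max => /andP[m1 m2] /andP[n1 n2].
  have -> : (u - v) m - (u - v) n = (u m - u n) - (v m - v n).
    rewrite -[LHS]/((u m - v m) - (u n - v n)).
    by rewrite !opprB [v n - _]addrC addrACA [- v m + _]addrC.
  by apply: (le_lt_trans (rnorm2B _ _)); rewrite gt_max uN// vN.
- move=> u v /asboolP cu /asboolP cv; apply/asboolP => e e0.
  have [M M0 uM] := cauchy2_bounded cu; have [M' M'0 vM] := cauchy2_bounded cv.
  have [N uN] := cu _ (divr_gt0 e0 M'0); have [N' vN] := cv _ (divr_gt0 e0 M0).
  exists (maxn N N') => m n; rewrite !geq_max => /andP[m1 m2] /andP[n1 n2].
  have -> : (u * v) m - (u * v) n = (u m - u n) * v m + u n * (v m - v n).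
    by rewrite !fctE mulrBl mulrBr addrA subrK.
  apply: (le_lt_trans (rnorm2D _ _)); rewrite gt_max !rnorm2M; apply/andP; split.
    apply: (le_lt_trans (ler_wpM2l (rnorm2_ge0 _) (vM m))).
    by rewrite -ltr_pdivlMr// uN.
  apply: (le_lt_trans (ler_wpM2r (rnorm2_ge0 _) (uM n))).
  by rewrite mulrC -ltr_pdivlMr// vN.
Qed.

HB.instance Definition _ :=
  GRing.isSubringClosed.Build (nat -> rat) cauchyb cauchy2_subring.

Record cseq := CSeq { cseq_val :> nat -> rat; _ : cauchyb cseq_val }.
HB.instance Definition _ := [isSub for cseq_val].
HB.instance Definition _ := [Choice of cseq by <:].
HB.instance Definition _ := [SubChoice_isSubComNzRing of cseq by <:].

Lemma cseqP (u : cseq) : cauchy2 u.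
Proof. by apply/asboolP; case: u. Qed.

Definition nullb : {pred cseq} := fun u => `[< null2 u >].

Lemma null2_ideal : idealr_closed nullb.
Proof.
split.
- by apply/asboolP => e e0; exists 0%N => n _; rewrite rnorm2_0.
- apply/asboolP => /(_ 1 ltr01) [N /(_ N (leqnn N))].
  by rewrite rnorm2_1 ltxx.
- move=> a u v /asboolP nu /asboolP nv; apply/asboolP => e e0.
  have [M M0 aM] := cauchy2_bounded (@cseqP a).
  have [N uN] := nu _ (divr_gt0 e0 M0); have [N' vN] := nv _ e0.
  exists (maxn N N') => n; rewrite geq_max => /andP[n1 n2].
  rewrite -[cseq_val _ n]/(a n * u n + v n).
  apply: (le_lt_trans (rnorm2D _ _)); rewrite gt_max vN// andbT rnorm2M.
  apply: (le_lt_trans (ler_wpM2r (rnorm2_ge0 _) (aM n))).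
  by rewrite mulrC -ltr_pdivlMr// uN.
Qed.

HB.instance Definition _ := isIdealr.Build cseq nullb null2_ideal.

(* The completion of (rat, rnorm2): 2-adic Cauchy sequences of rationals modulo
   2-adic null sequences. *)
Definition Q2 : Type := {ideal_quot nullb}.
HB.instance Definition _ := GRing.ComNzRing.on Q2.
HB.instance Definition _ := EqQuotient.on Q2.

Lemma rnorm2_isosceles x y : rnorm2 (x - y) < rnorm2 y -> rnorm2 x = rnorm2 y.
Proof.
move=> xy; apply/eqP; rewrite eq_le; apply/andP; split.
  by rewrite -[x in leLHS](subrK y) (le_trans (rnorm2D _ _))// ge_max lexx ltW.
rewrite leNgt; apply/negP => ltxy.
have := rnorm2B x (x - y); rewrite subKr leNgt gt_max ltxy xy.
by [].
Qed.

Lemma cauchy2_stable (u : nat -> rat) : cauchy2 u -> ~ null2 u ->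
  exists N c, 0 < c /\ forall n, (N <= n)%N -> rnorm2 (u n) = c.
Proof.
move=> cu /existsNP[e /not_implyP[e0 /forallNP nu]].
have [N uN] := cu _ e0.
have /existsNP[m /not_implyP[Nm /negP]] := nu N; rewrite -leNgt => em.
exists N, (rnorm2 (u m)); split; first exact: lt_le_trans em.
move=> n Nn; apply: rnorm2_isosceles.
exact: lt_le_trans (uN _ _ Nn Nm) em.
Qed.

Lemma cauchy2V (u : nat -> rat) : cauchy2 u -> ~ null2 u ->
  cauchy2 (fun n => (u n)^-1).
Proof.
move=> cu nu; have [N [c [c0 uc]]] := cauchy2_stable cu nu => e e0.
have [N' uN] := cu _ (mulr_gt0 e0 (mulr_gt0 c0 c0)).
exists (maxn N N') => m n; rewrite !geq_max => /andP[m1 m2] /andP[n1 n2].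
have um0 : u m != 0 by rewrite -rnorm2_eq0 uc// gt_eqF.
have un0 : u n != 0 by rewrite -rnorm2_eq0 uc// gt_eqF.
have -> : (u m)^-1 - (u n)^-1 = (u n - u m) / (u m * u n).
  by rewrite mulrBl invfM mulrCA divff// mulr1 mulrA divff// mul1r.
rewrite rnorm2M rnorm2V rnorm2M uc// uc// ltr_pdivrMr ?mulr_gt0//.
exact: uN.
Qed.

Definition cinv (u : cseq) : cseq := insubd 0 (fun n => (u n)^-1).

Lemma Q2_eq0 (u : cseq) : (\pi_Q2%qT u == 0) = `[< null2 u >].
Proof.
have -> : (0 : Q2) = \pi_Q2%qT 0 by rewrite pi_zeror.
by rewrite -Quotient.idealrBE subr0.
Qed.

Definition Q2_inv (x : Q2) : Q2 :=
  if x == 0 then 0 else \pi_Q2%qT (cinv (repr x)).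

Lemma Q2_mulVf x : x != 0 -> Q2_inv x * x = 1.
Proof.
move=> x0; rewrite /Q2_inv (negPf x0) -{2}[x]reprK.
have /asboolPn nu : ~~ `[< null2 (repr x) >] by rewrite -Q2_eq0 reprK.
have cu := @cseqP (repr x).
rewrite -pi_mulr -pi_oner; apply/eqP; rewrite -Quotient.idealrBE.
apply/asboolP => e e0; have [N [c [c0 uc]]] := cauchy2_stable cu nu.
exists N => n Nn.
rewrite -[cseq_val _ n]/(cseq_val (cinv (repr x)) n * (repr x : cseq) n - 1).
rewrite /cinv -[cseq_val (insubd _ _)]/(val _) val_insubd ifT; last first.
  by apply/asboolP; exact: cauchy2V.
by rewrite mulVf ?subrr ?rnorm2_0// -rnorm2_eq0 uc// gt_eqF.
Qed.

Lemma Q2_inv0 : Q2_inv 0 = 0. Proof. by rewrite /Q2_inv eqxx. Qed.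

HB.instance Definition _ := GRing.ComNzRing_isField.Build Q2 Q2_mulVf Q2_inv0.

(* |x|_2 = lim |u_n|_2 for a Cauchy sequence u representing x; norm2_cvg shows
   that the limit exists and does not depend on u. This cannot be a
   normedZmodType structure, whose norm must satisfy |x *+ n| = |x| *+ n. *)
Definition norm2 (x : Q2) : rat :=
  lim ((rnorm2 ((repr x : cseq) n) : rat^o) @[n --> \oo]).

Lemma norm2_cvg (u : cseq) :
  (rnorm2 (u n) : rat^o) @[n --> \oo] --> (norm2 (\pi_Q2%qT u) : rat^o).
Proof.
have cst (v : cseq) N c : (forall n, (N <= n)%N -> rnorm2 (v n) = c) ->
    (rnorm2 (v n) : rat^o) @[n --> \oo] --> (c : rat^o).
  move=> vc; apply/cvgrPdist_lt => e e0; near=> n.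
  by rewrite vc ?subrr ?normr0//; near: n; exact: nbhs_infty_ge.
have nul (v : cseq) : null2 v ->
    (rnorm2 (v n) : rat^o) @[n --> \oo] --> (0 : rat^o).
  move=> v0; apply/cvgrPdist_lt => e /v0[N vN]; near=> n.
  rewrite sub0r normrN ger0_norm ?rnorm2_ge0// vN//.
  by near: n; exact: nbhs_infty_ge.
set v := repr (\pi_Q2%qT u).
have uv : null2 (u - v).
  by apply/asboolP; rewrite -Q2_eq0 pi_addr pi_oppr reprK subrr.
have [u0|nu] := pselect (null2 u).
  have v0 : null2 v.
    by apply/asboolP; rewrite -Q2_eq0 reprK Q2_eq0; apply/asboolP.
  by rewrite /norm2 (cvg_lim _ (nul _ v0))//; exact: nul.
have [N [c [c0 uc]]] := cauchy2_stable (@cseqP u) nu.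
have [N' uvN] := uv _ c0.
have vc n : (maxn N N' <= n)%N -> rnorm2 (v n) = c.
  rewrite geq_max => /andP[n1 n2]; rewrite -(uc _ n1).
  apply: rnorm2_isosceles; rewrite -rnorm2N opprB uc//.
  exact: uvN.
by rewrite /norm2 (cvg_lim _ (cst _ _ _ vc))//; exact: cst uc.
Unshelve. all: by end_near. Qed.

Lemma norm2_lim (u : cseq) (l : rat) :
  (rnorm2 (u n) : rat^o) @[n --> \oo] --> (l : rat^o) -> norm2 (\pi_Q2%qT u) = l.
Proof.
have H : hausdorff_space rat^o by exact: norm_hausdorff.
move=> ul; exact: (cvg_unique H (@norm2_cvg u) ul).
Qed.

Lemma norm2_0 : norm2 0 = 0.
Proof.
have -> : (0 : Q2) = \pi_Q2%qT 0 by rewrite pi_zeror.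
apply: norm2_lim; rewrite [X in X @ _](_ : _ = fun=> 0); first exact: cvg_cst.
by apply/funext => n; exact: rnorm2_0.
Qed.

Lemma norm2_eq0 x : norm2 x = 0 -> x = 0.
Proof.
move=> x0; apply/eqP; rewrite -[x]reprK Q2_eq0; apply/asboolP.
apply: contrapT => nu.
have [N [c [c0 uc]]] := cauchy2_stable (@cseqP (repr x)) nu.
have : c <= norm2 x.
  have := @norm2_cvg (repr x); rewrite reprK => /cvgr_to_ge; apply.
  by near=> n; rewrite uc//; near: n; exact: nbhs_infty_ge.
by rewrite x0 leNgt c0.
Unshelve. all: by end_near. Qed.

Lemma norm2N x : norm2 (- x) = norm2 x.
Proof.
rewrite -{1}[x]reprK -pi_oppr; apply: norm2_lim.
rewrite [X in X @ _](_ : _ = fun n => rnorm2 ((repr x : cseq) n)).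
  by have := @norm2_cvg (repr x); rewrite reprK.
by apply/funext => n; rewrite -rnorm2N opprK.
Qed.

Lemma norm2M : {morph norm2 : x y / x * y}.
Proof.
move=> x y; rewrite -{1}[x]reprK -{1}[y]reprK -pi_mulr; apply: norm2_lim.
rewrite [X in X @ _](_ : _ = (fun n => rnorm2 ((repr x : cseq) n)) \*
   (fun n => rnorm2 ((repr y : cseq) n))).
  have hx := @norm2_cvg (repr x); have hy := @norm2_cvg (repr y).
  by rewrite !reprK in hx hy; exact: cvgM hx hy.
by apply/funext => n; rewrite /= -rnorm2M.
Qed.

Lemma norm2D x y : norm2 (x + y) <= Num.max (norm2 x) (norm2 y).
Proof.
rewrite leNgt; apply/negP => /midf_lt[]; set z := (_ / _).
have hx := @norm2_cvg (repr x); have hy := @norm2_cvg (repr y).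
have := @norm2_cvg (repr x + repr y); rewrite pi_addr !reprK in hx hy * => hxy.
rewrite gt_max => /andP[xz yz] zxy.
have /filter_ex[n [[]]] : \forall n \near \oo,
    (rnorm2 ((repr x : cseq) n) < z /\ rnorm2 ((repr y : cseq) n) < z) /\
    z < rnorm2 ((repr x + repr y : cseq) n).
  near=> n; split; first split.
  - by near: n; exact: (cvgr_lt _ hx).
  - by near: n; exact: (cvgr_lt _ hy).
  - by near: n; exact: (cvgr_gt _ hxy).
move=> xn yn; apply/negP; rewrite -leNgt.
by apply: (le_trans (rnorm2D _ _)); rewrite ge_max !ltW.
Unshelve. all: by end_near. Qed.

Lemma norm2_ge0 x : 0 <= norm2 x.
Proof.
by have := norm2D x (- x); rewrite subrr norm2_0 norm2N maxxx.
Qed.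

Definition dist2 (x y : Q2) : rat := norm2 (x - y).

Lemma dist2xx x : dist2 x x = 0. Proof. by rewrite /dist2 subrr norm2_0. Qed.

Lemma dist2_eq0 x y : dist2 x y = 0 -> x = y.
Proof. by move=> /norm2_eq0/eqP; rewrite subr_eq0 => /eqP. Qed.

Lemma dist2C x y : dist2 x y = dist2 y x.
Proof. by rewrite /dist2 -norm2N opprB. Qed.

Lemma dist2_triangle y x z : dist2 x z <= dist2 x y + dist2 y z.
Proof.
rewrite /dist2; have -> : x - z = (x - y) + (y - z) by rewrite addrA subrK.
apply: (le_trans (norm2D _ _)).
by rewrite ge_max lerDl lerDr !norm2_ge0.
Qed.

HB.instance Definition _ := isPointed.Build Q2 0.
HB.instance Definition _ :=
  isMetric.Build rat Q2 dist2xx dist2_eq0 dist2C dist2_triangle.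

Definition norm_value : set rat := [set r | exists k : int, r = 2%:Q ^ k].

Definition sphere (r : rat) : set Q2 := [set x | norm2 x = r].

Definition cball (c : Q2) (rho : rat) : set Q2 := [set x | norm2 (x - c) <= rho].

Definition fmap2 (a b d x : Q2) : Q2 :=
  (a * x ^+ 2 + b * x) / (x ^+ 2 + d * x + b).

(* The set I, with na = |a|_2. *)
Definition radii (na alpha beta : rat) : set rat :=
  [set r | norm_value r /\
    [\/ na < beta /\ 0 < r < alpha,
        na = beta /\ (0 < r < alpha \/ alpha < r < beta)
      | beta < na /\ 0 < r < alpha * beta / na]].

Definition set_algebra {T : Type} (X : set T) (G : set (set T)) : Prop :=
  [/\ G X, forall A, G A -> G (X `\` A) & setU_closed G].

(* Spheres are closed in Q2, so the closed subsets of X = sphere r are the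
   closed subsets of Q2 contained in X. The generated algebra (finite unions) is
   contained in the Borel sigma-algebra, where the measure below is defined. *)
Definition closed_algebra (X : set Q2) : set (set Q2) :=
  smallest (set_algebra X) [set A | closed A /\ A `<=` X].

Definition borelQ2 := g_sigma_algebraType (@open Q2).

(* The normalized Haar measure on the sphere of radius r, extended by zero to the
   Borel sets of Q2; it is determined by its values p rho / ((p - 1) r), p = 2,
   on closed balls. *)
Definition haar_sphere {R : realType} (r : rat) (mu : probability borelQ2 R) :=
  mu (sphere r) = 1%E /\
  forall c rho, norm_value rho -> cball c rho `<=` sphere r ->
    mu (cball c rho) = (ratr (2 * rho / ((2 - 1) * r)))%:E.

(* V is invariant when its preimage under the restriction of f to X is V. *)
Definition ergodic {R : realType} (X : set Q2) (f : Q2 -> Q2)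
    (mu : probability borelQ2 R) : Prop :=
  forall V, closed_algebra X V -> X `&` f @^-1` V = V ->
    mu V = 0%E \/ mu V = 1%E.

(* Main.v *)
(* On the sphere S_r the divided difference m(x, y) = (f y - f x) / (y - x) is a
   unit of Z_2 congruent modulo 4 to a fixed sign, and |f x - x| <= r / 2.

   If m = 1 mod 4 and |f x - x| = r / 2 everywhere, doubling the number of
   iterations halves the displacement, |f^(2^k) x - x| = r / 2^(k+1), so every
   orbit is dense in S_r. A set of the algebra generated by the closed sets is,
   inside any ball, equal to the full or to the empty set on some smaller ball;
   when it is invariant, density of the orbits makes it S_r or empty.

   Otherwise |f (f x) - x| <= r / 8 on S_r, and the union of the balls of radius
   r / 8 around x and f x is an invariant set of measure between 1/4 and 1/2.

   For r < alpha one finds m = 1 - x^2 / b mod 4 and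
   |f x - x| = r^2 |a - d - x| / |b|; for alpha < r < beta one finds
   m = a / d mod 4 and |f x - x| = r |a - d - x| / |d|. *)

Require Import Defs.
From HB Require Import structures.
From mathcomp Require Import all_boot all_order all_algebra.
From mathcomp Require Import generic_quotient ring_quotient ring lra zify.
From mathcomp Require Import all_classical all_reals all_analysis.

Import Order.TTheory GRing.Theory Num.Theory.

Local Open Scope classical_set_scope.
Local Open Scope ring_scope.

(** * The residue field with two elements: differences of elements of equal norm *)

Lemma rnorm2_residue (p q : rat) :
  rnorm2 p = rnorm2 q -> rnorm2 (p - q) <= rnorm2 q / 2.
Proof.
have [->|q0] := eqVneq q 0.
  by move=> /eqP; rewrite rnorm2_0 rnorm2_eq0 => /eqP ->; rewrite subr0 rnorm2_0 mul0r.
move=> pq; have nq0 : rnorm2 q != 0 by rewrite rnorm2_eq0.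
set t := p / q.
have t1 : rnorm2 t = 1 by rewrite rnorm2M rnorm2V pq divff.
have -> : p - q = q * (t - 1) by rewrite mulrBr mulr1 mulrCA divff ?mulr1.
rewrite rnorm2M ler_wpM2l ?rnorm2_ge0//.
have [->|tn1] := eqVneq (t - 1) 0; first by rewrite rnorm2_0.
have t0 : t != 0 by rewrite -rnorm2_eq0 t1.
have E : logn 2 `|denq t| = logn 2 `|numq t|.
  move: t1; rewrite /rnorm2 (negPf t0) -[RHS](expr0z 2%:Q).
  by move=> /(ieexprIz (isT : 0 < 2%:Q) isT); lia.
have cop := coprime_num_den t.
have oddn n : (0 < n)%N -> logn 2 n = 0%N -> odd n.
  move=> n0 l0; apply/negPn/negP; rewrite -dvdn2 => d2.
  by have := logn_gt0 2 n; rewrite l0 mem_primes n0 d2.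
have nt : (0 < `|numq t|)%N by rewrite absz_gt0 numq_eq0.
have dt : (0 < `|denq t|)%N by rewrite absz_gt0 denq_eq0.
have l0 : logn 2 `|denq t| = 0%N.
  apply/eqP; rewrite -leqn0 leqNgt; apply/negP => gt0.
  have gt0' := gt0; rewrite E in gt0'.
  move: gt0 gt0'; rewrite !logn_gt0 !mem_primes => /and3P[_ _ h1] /and3P[_ _ h2].
  have : (2 %| gcdn `|numq t| `|denq t|)%N by rewrite dvdn_gcd h1 h2.
  by move: cop; rewrite /coprime => /eqP ->.
(* In lowest terms the unit [t] is a quotient of two odd integers, so [t - 1] has an even numerator
   over an odd denominator. *)
have od := oddn _ dt l0; have on := oddn _ nt (etrans (esym E) l0).
have Et : t - 1 = (numq t - denq t)%:~R / (denq t)%:~R.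
  by rewrite intrB mulrBl divff ?intr_eq0 ?denq_eq0// divq_num_den.
have n0 : numq t - denq t != 0.
  by apply: contraNneq tn1 => n0; rewrite Et n0 mul0r.
rewrite Et rnorm2_frac ?denq_eq0// l0 sub0r.
rewrite -[X in _ <= X]/(2%:Q ^ (-1)) ler_eXz2l// lerN2 lez_nat.
rewrite logn_gt0 mem_primes absz_gt0 n0/=; lia.
Qed.

(** The rational inequality passes to the limit, because a Cauchy sequence representing a nonzero
    element has eventually constant norm. This is how [p = 2] enters: all units are congruent modulo
    2. *)
Lemma norm2_residue (x y : Q2) :
  norm2 x = norm2 y -> norm2 (x - y) <= norm2 y / 2.
Proof.
have [->|y0] := eqVneq y 0.
  by rewrite norm2_0 => /norm2_eq0 ->; rewrite subr0 norm2_0 mul0r.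
move=> xy; have hx := @norm2_cvg (repr x); have hy := @norm2_cvg (repr y).
have hxy := @norm2_cvg (repr x - repr y).
rewrite pi_addr pi_oppr !reprK in hx hy hxy.
have stable (z : Q2) : z != 0 -> exists N, forall n, (N <= n)%N ->
    rnorm2 ((repr z : cseq) n) = norm2 z.
  move=> z0.
  have /asboolPn nu : ~~ `[< null2 (repr z) >] by rewrite -Q2_eq0 reprK.
  have [N [c [c0 uc]]] := cauchy2_stable (@cseqP (repr z)) nu.
  exists N => n Nn; rewrite uc//; rewrite -[z]reprK; apply/esym/norm2_lim.
  apply: (cvg_near_cst (c : rat^o)); near=> m; rewrite uc//.
  by near: m; exact: nbhs_infty_ge.
have x0 : x != 0.
  by apply: contraNneq y0 => x0; apply/eqP/norm2_eq0; rewrite -xy x0 norm2_0.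
have [N xN] := stable _ x0; have [M yM] := stable _ y0.
have /cvgr_to_le := hxy; apply; near=> n.
rewrite -(yM n); last by near: n; exact: nbhs_infty_ge.
apply: rnorm2_residue; rewrite xN ?yM//; near: n; exact: nbhs_infty_ge.
Unshelve. all: by end_near. Qed.

(** * Ultrametric rules and discreteness of the norm *)

Lemma norm2_neq0 (x : Q2) : x != 0 -> norm2 x != 0.
Proof. by apply: contra_neq => /norm2_eq0. Qed.

Lemma norm2_gt0 (x : Q2) : x != 0 -> 0 < norm2 x.
Proof. by move=> x0; rewrite lt_neqAle eq_sym norm2_neq0// norm2_ge0. Qed.

Lemma norm2_1 : norm2 1 = 1.
Proof.
have n0 := norm2_neq0 _ (oner_neq0 Q2).
by apply: (mulfI n0); rewrite -norm2M !mulr1.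
Qed.

Lemma norm2V (x : Q2) : norm2 x^-1 = (norm2 x)^-1.
Proof.
have [->|x0] := eqVneq x 0; first by rewrite invr0 norm2_0 invr0.
have n0 := norm2_neq0 _ x0.
by apply: (mulIf n0); rewrite -norm2M !mulVf ?norm2_neq0// norm2_1.
Qed.

Lemma norm2_2 : norm2 2 = 1 / 2.
Proof.
have -> : (2 : Q2) = \pi_Q2%qT 2 by rewrite -[2]/(1 + 1) -[in RHS]/(1 + 1) pi_addr pi_oner.
apply: norm2_lim; apply: (cvg_near_cst (1 / 2 : rat^o)); near=> n.
by [].
Unshelve. all: by end_near. Qed.

Lemma Q2_2_neq0 : 2 != 0 :> Q2.
Proof. by apply/eqP => E; have := norm2_2; rewrite E norm2_0. Qed.

Lemma norm2B (x y : Q2) : norm2 (x - y) <= Num.max (norm2 x) (norm2 y).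
Proof. by rewrite -(norm2N y) norm2D. Qed.

Lemma norm2_sym (x y : Q2) : norm2 (x - y) = norm2 (y - x).
Proof. by rewrite -norm2N opprB. Qed.

Lemma norm2D_le (x y : Q2) e : norm2 x <= e -> norm2 y <= e -> norm2 (x + y) <= e.
Proof. by move=> xe ye; apply: le_trans (norm2D _ _) _; rewrite ge_max xe. Qed.

Lemma norm2B_le (x y : Q2) e : norm2 x <= e -> norm2 y <= e -> norm2 (x - y) <= e.
Proof. by move=> xe ye; apply: norm2D_le; rewrite ?norm2N. Qed.

Lemma norm2D_lt (x y : Q2) : norm2 x < norm2 y -> norm2 (x + y) = norm2 y.
Proof.
move=> xy; apply/eqP; rewrite eq_le norm2D_le ?(ltW xy)//=.
have := norm2B (x + y) x; rewrite addrAC subrr add0r.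
by rewrite le_max [_ <= norm2 x]leNgt xy orbF.
Qed.

Lemma norm2B_lt (x y : Q2) : norm2 x < norm2 y -> norm2 (x - y) = norm2 y.
Proof. by move=> xy; rewrite -[RHS]norm2N norm2D_lt// norm2N. Qed.

Lemma norm2_value (x : Q2) : x != 0 -> norm_value (norm2 x).
Proof.
move=> x0.
have /asboolPn nu : ~~ `[< null2 (repr x) >] by rewrite -Q2_eq0 reprK.
have [N [c [c0 uc]]] := cauchy2_stable (@cseqP (repr x)) nu.
have -> : norm2 x = c.
  rewrite -[x]reprK; apply: norm2_lim.
  apply: (cvg_near_cst (c : rat^o)); near=> m; rewrite uc//.
  by near: m; exact: nbhs_infty_ge.
have := uc _ (leqnn N); rewrite /rnorm2; case: ifP => [_ c00|_ <-].
  by rewrite -c00 ltxx in c0.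
by eexists.
Unshelve. all: by end_near. Qed.

Lemma norm_value_gt0 r : norm_value r -> 0 < r.
Proof. by move=> [k ->]; apply: exprz_gt0. Qed.

Lemma norm_value_half r : norm_value r -> norm_value (r / 2).
Proof. by move=> [k ->]; exists (k - 1); rewrite expfzDr. Qed.

(** Discreteness: there is no power of 2 strictly between [s / 2] and [s]. Strict bounds on norms
    are sharpened this way throughout. *)
Lemma norm_value_lt r s : norm_value r -> norm_value s -> r < s -> r <= s / 2.
Proof.
move=> [k ->] [l ->]; rewrite ltr_eXz2l// => kl.
rewrite -[2^-1]/(2%:Q ^ (-1)) -expfzDr// ler_eXz2l//.
by move: kl; lia.
Qed.

Lemma norm2_lt_half (x : Q2) s : norm_value s -> norm2 x < s -> norm2 x <= s / 2.
Proof.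
have [->|x0] := eqVneq x 0.
  by move=> /norm_value_gt0 s0 _; rewrite norm2_0 divr_ge0// ltW.
by move=> vs; apply: norm_value_lt => //; apply: norm2_value.
Qed.

(** * Balls, and the algebra generated by the closed sets *)

Lemma cball_sphere (c : Q2) (rho r : rat) :
  norm2 c = r -> rho < r -> cball c rho `<=` sphere r.
Proof.
move=> cr rr x xc; rewrite /sphere/= -[x](subrK c) norm2D_lt//.
by rewrite cr; apply: le_lt_trans rr.
Qed.

Lemma cball_center (x y : Q2) rho : cball x rho y -> cball y rho = cball x rho.
Proof.
rewrite /cball/= => yx; apply/seteqP; split => z /= zy.
  by rewrite -[z](subrK y) -addrA norm2D_le.
rewrite -[z](subrK x) -addrA norm2D_le// norm2_sym.
by [].
Qed.

Lemma closed_cball2 (c : Q2) rho : 0 < rho -> closed (cball c rho).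
Proof.
move=> rho0; rewrite -[cball c rho]setCK; apply: open_closedC.
rewrite openE => x /= xc; rewrite /interior; apply/nbhs_ballP.
exists rho => //= y; rewrite ballEmdist /= /mdist/= /dist2 => xy yc.
by apply: xc; rewrite /cball/= -[x](subrK y) -addrA norm2D_le// ltW.
Qed.

Lemma closed_measurable_borelQ2 (A : set Q2) :
  closed A -> measurable (A : set borelQ2).
Proof.
move=> cA; rewrite -[A]setCK; apply: measurableC.
by apply: sub_sigma_algebra; exact: closed_openC.
Qed.

(** A closed set either contains a given ball or misses a point of it, hence a small ball around
    that point. The dichotomy survives complements, and unions by refining twice. *)
Lemma closed_algebra_split (r : rat) (V : set Q2) (c : Q2) (rho : rat) :
  closed_algebra (sphere r) V -> norm2 c = r -> 0 < rho < r ->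
  exists c' rho', [/\ 0 < rho' < r, norm2 c' = r &
    cball c' rho' `<=` V \/ cball c' rho' `&` V = set0].
Proof.
(* The strengthened property places the new ball inside the given one; without this the two
   refinements for a union could not be nested. *)
suff : closed_algebra (sphere r) `<=` [set V | forall c rho, norm2 c = r ->
    0 < rho < r -> exists c' rho', [/\ 0 < rho' <= rho, cball c rho c' &
    cball c' rho' `<=` V \/ cball c' rho' `&` V = set0]].
  move=> /[apply] /(_ c rho) H cr rr; have [c' [rho' [r1 c1 h]]] := H cr rr.
  have /andP[rho0 rhor] := rr; have /andP[rho'0 rho'rho] := r1.
  exists c', rho'; split => //; first by rewrite rho'0 (le_lt_trans rho'rho).
  exact: (cball_sphere _ _ _ cr rhor).
have self (x : Q2) e : 0 < e -> cball x e x.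
  by move=> e0; rewrite /cball/= subrr norm2_0 ltW.
apply: smallest_sub; last first.
  move=> V' [cV VS] c' rho' cr /andP[rho0 rhor].
  have [sub|/existsNP[z /not_implyP[zc zV]]] := pselect (cball c' rho' `<=` V').
    exists c', rho'; rewrite lexx rho0; split => //; [exact: self|by left].
  have := closed_openC cV; rewrite openE => /(_ z zV).
  rewrite /interior => /nbhs_ballP[e /= e0 eV].
  (* Halving [e] fits the closed ball into the open ball of radius [e] that avoids the closed
     set. *)
  exists z, (Num.min rho' (e / 2)); split => //.
    by rewrite ge_min lexx lt_min rho0 divr_gt0.
  right; apply/seteqP; split => // y [yz Vy]; apply: (eV y) => //.
  rewrite ballEmdist /= /mdist/= /dist2 norm2_sym.
  move: yz; rewrite /cball/= le_min => /andP[_ h].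
  by apply: le_lt_trans h _; rewrite ltr_pdivrMr// ltr_pMr// ltr1n.
split.
- move=> c' rho' cr /andP[rho0 rhor]; exists c', rho'; rewrite lexx rho0.
  by split => //; [exact: self|left; exact: cball_sphere].
- move=> A HA c' rho' cr rr; have [c2 [rho2 [r2 h2 [h|h]]]] := HA _ _ cr rr.
    exists c2, rho2; split => //; right; apply/seteqP; split => // y [yc [_ nA]].
    exact/nA/h.
  exists c2, rho2; split => //; left => y yc; split; last first.
    by move=> Ay; have : set0 y by rewrite -h.
  have /andP[_ rhor] := rr; have /andP[_ rho2rho] := r2.
  apply: (cball_sphere c2 rho2) yc; last exact: le_lt_trans rhor.
  exact: (cball_sphere _ _ _ cr rhor).
- move=> A B HA HB c' rho' cr rr.
  have /andP[rho0 rhor] := rr.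
  have [c2 [rho2 [r2 h2 [h|h]]]] := HA _ _ cr rr.
    by exists c2, rho2; split => //; left => y yc; left; exact: h.
  have /andP[rho20 rho2rho] := r2.
  have c2r : norm2 c2 = r by exact: (cball_sphere _ _ _ cr rhor).
  (* [A] misses the ball around [c2], so [B] alone decides the union inside it. *)
  have [|c3 [rho3 [r3 h3 h']]] := HB c2 rho2 c2r.
    by rewrite rho20 (le_lt_trans rho2rho).
  have /andP[rho30 rho3rho2] := r3.
  have sub : cball c3 rho3 `<=` cball c2 rho2.
    by rewrite -(cball_center _ _ _ h3) => y /le_trans; exact.
  exists c3, rho3; split.
  + by rewrite rho30 (le_trans rho3rho2).
  + rewrite -(cball_center _ _ _ h2).
    by apply: le_trans h3 _.
  + case: h' => [h'|h']; [left => y yc; right; exact: h'|right].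
    rewrite setIUr h' setU0; apply/seteqP; split => // y [yc Ay].
    by rewrite -h; split => //; apply: sub.
Qed.

Lemma sphere_nonempty r : norm_value r -> sphere r !=set0.
Proof.
move=> [k ->]; exists (2 ^ (- k)).
have pw n : norm2 (2 ^+ n) = (1 / 2) ^+ n.
  by elim: n => [|n IH]; rewrite ?norm2_1// !exprS norm2M norm2_2 IH.
rewrite /sphere/=; case: k => n.
- by rewrite -exprnN norm2V pw mul1r exprVn invrK.
- by rewrite !NegzE opprK -!exprnP pw mul1r exprVn exprnN.
Qed.

(** * Criteria for ergodicity and for its failure on an invariant sphere *)

Section dynamics.
Variables (r : rat) (f : Q2 -> Q2).
Hypothesis vr : norm_value r.
Hypothesis fS : forall x, norm2 x = r -> norm2 (f x) = r.

Let r0 : 0 < r. Proof. exact: norm_value_gt0. Qed.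

Let iterS n x : norm2 x = r -> norm2 (iter n f x) = r.
Proof. by move=> xr; elim: n => //= n; exact: fS. Qed.

Section minimal.
Hypothesis f_move : forall x, norm2 x = r -> norm2 (f x - x) = r / 2.
Hypothesis f_mod4 : forall x y, norm2 x = r -> norm2 y = r ->
  norm2 (f y - f x - (y - x)) <= norm2 (y - x) / 4.

(** The congruence modulo 4 composes, since a map satisfying it does not increase distances. *)
Let iter_mod4 n x y : norm2 x = r -> norm2 y = r ->
  norm2 (iter n f y - iter n f x - (y - x)) <= norm2 (y - x) / 4.
Proof.
move=> xr yr; elim: n => [|n IH]; first by rewrite subrr norm2_0 divr_ge0// norm2_ge0.
have E : norm2 (iter n f y - iter n f x) <= norm2 (y - x).
  rewrite -[X in norm2 X](subrK (y - x)); apply: norm2D_le => //.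
  apply: le_trans IH _; have := norm2_ge0 (y - x); lra.
rewrite /=; set u := iter n f x in IH E *; set v := iter n f y in IH E *.
have -> : f v - f u - (y - x) = (f v - f u - (v - u)) + (v - u - (y - x)) by ring.
apply: norm2D_le => //; apply: le_trans (f_mod4 _ _ (iterS _ _ xr) (iterS _ _ yr)) _.
by rewrite ler_wpM2r.
Qed.

(** With [g] the iterate of order [2 ^ k], [g (g x) - x] is [2 * (g x - x)] plus an error of norm at
    most a quarter of that of [g x - x]. The first term dominates, so the displacement is exactly
    halved. *)
Lemma norm2_iter_pow2 k x : norm2 x = r ->
  norm2 (iter (2 ^ k) f x - x) = r / 2 ^+ k.+1.
Proof.
elim: k x => [|k IH] x xr; first by rewrite f_move.
set g := iter (2 ^ k) f.
have gE : iter (2 ^ k.+1) f x = g (g x) by rewrite expnS mul2n -addnn iterD.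
have gr : norm2 (g x) = r by exact: iterS.
have -> : iter (2 ^ k.+1) f x - x = (g (g x) - g x - (g x - x)) + 2 * (g x - x).
  by rewrite gE; ring.
have nE : norm2 (2 * (g x - x)) = r / 2 ^+ k.+2.
  by rewrite norm2M norm2_2 IH// [in RHS]exprS; field; rewrite expf_neq0.
rewrite norm2D_lt ?nE//; apply: le_lt_trans (iter_mod4 _ _ _ xr gr) _.
have e0 : 0 < r / 2 ^+ k.+1 by rewrite divr_gt0// exprn_gt0.
by rewrite IH// [in ltRHS]exprSr invfM mulrA; lra.
Qed.

(** Bisection: when the orbit is at distance exactly [r / 2 ^ k] from [c], an iterate displacing by
    that same amount brings it closer, as two elements of equal norm differ by at most half of
    it. *)
Lemma orbit_approx k x c : norm2 x = r -> norm2 c = r ->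
  exists n, norm2 (iter n f x - c) <= r / 2 ^+ k.
Proof.
move=> xr cr; elim: k => [|k [n IH]].
  by exists 0%N; rewrite expr0 divr1 norm2B_le ?xr ?cr.
have vk : norm_value (r / 2 ^+ k).
  elim: k {IH} => [|k IH]; first by rewrite expr0 divr1.
  by rewrite exprSr invfM mulrA; exact: norm_value_half.
have [lt|ge] := ltP (norm2 (iter n f x - c)) (r / 2 ^+ k).
  by exists n; rewrite exprSr invfM mulrA; exact: norm2_lt_half.
have eq : norm2 (iter n f x - c) = r / 2 ^+ k by apply/eqP; rewrite eq_le IH ge.
case: k vk {ge} IH eq => [_ _|k vk IH eq].
  rewrite expr0 divr1 => eq; exists n; rewrite expr1 -cr; apply: norm2_residue.
  by rewrite iterS// cr.
exists (2 ^ k + n)%N; rewrite iterD; set y := iter n f x in IH eq *.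
have yr : norm2 y = r by exact: iterS.
have -> : iter (2 ^ k) f y - c = (iter (2 ^ k) f y - y) - (c - y) by ring.
rewrite (exprSr _ k.+1) invfM mulrA -eq (norm2_sym y c).
by apply: norm2_residue; rewrite norm2_iter_pow2// norm2_sym eq.
Qed.

Lemma ergodic_of_mod4 (R : realType) (mu : probability borelQ2 R) :
  mu (sphere r) = 1%E -> ergodic (sphere r) f mu.
Proof.
move=> muS V algV inv.
have hit c rho x : 0 < rho -> norm2 c = r -> norm2 x = r ->
    exists n, cball c rho (iter n f x).
  move=> rho0 cr xr; have [k kP] : exists k, r / 2 ^+ k <= rho.
    have kP := archi_boundP (divr_ge0 (ltW r0) (ltW rho0)).
    (* The Archimedean bound [N] of [r / rho] works because [N < 2 ^ N]. *)
    exists (Num.bound (r / rho)).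
    rewrite ler_pdivrMr ?exprn_gt0// -ler_pdivrMl// mulrC.
    apply: ltW (lt_le_trans kP _).
    by rewrite -natrX ler_nat ltnW// ltn_expl.
  by have [n nP] := orbit_approx k x c xr cr; exists n; exact: le_trans nP kP.
have inS x : V x -> norm2 x = r by rewrite -inv => -[].
have VP n x : norm2 x = r -> V (iter n f x) <-> V x.
  move=> xr; elim: n => //= n <-; rewrite -[in X in _ <-> X]inv; split => [h|[]//].
  by split => //; exact: iterS.
have [c cr] := sphere_nonempty _ vr.
have [|c' [rho [/andP[rho0 _] c'r h]]] := closed_algebra_split _ _ c (r / 2) algV cr.
  by move: r0 => ?; apply/andP; split; lra.
case: h => h; [right|left].
  suff -> : V = sphere r by [].
  apply/seteqP; split => [x /inS//|x xr].
  by have [n /h] := hit _ _ _ rho0 c'r xr; rewrite VP.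
suff -> : V = set0 by rewrite measure0.
apply/seteqP; split => // x Vx; have xr := inS _ Vx.
have [n nP] := hit _ _ _ rho0 c'r xr.
have : (cball c' rho `&` V) (iter n f x) by split => //; rewrite VP.
by rewrite h.
Qed.

End minimal.

(** Being nonexpanding, [f] maps the ball of radius [r / 8] around [y] into the one around [f y],
    and [f] applied twice sends each such ball into itself. The balls around [x] and [f x] are
    therefore exchanged, or coincide. *)
Lemma not_ergodic_of_square (R : realType) (mu : probability borelQ2 R) :
  haar_sphere r mu ->
  (forall x y, norm2 x = r -> norm2 y = r -> norm2 (f y - f x) <= norm2 (y - x)) ->
  (forall x, norm2 x = r -> norm2 (f (f x) - x) <= r / 8) ->
  ~ ergodic (sphere r) f mu.
Proof.
move=> [_ muB] lip sq erg.
have [x xr] := sphere_nonempty _ vr; rewrite /sphere/= in xr.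
have rgt0 := r0; have r8 : 0 < r / 8 by lra.
have r8r : r / 8 < r by lra.
have v8 : norm_value (r / 8).
  rewrite (_ : r / 8 = r / 2 / 2 / 2); last by field.
  by do 3!apply: norm_value_half.
have mu_ball c : norm2 c = r -> mu (cball c (r / 8)) = (4^-1)%:E.
  move=> cr; rewrite muB//; last exact: cball_sphere.
  have -> : 2 * (r / 8) / ((2 - 1) * r) = 4^-1 by field; rewrite gt_eqF.
  by rewrite fmorphV rmorph_nat.
have ball_lip u y : norm2 u = r -> norm2 y = r -> cball u (r / 8) y ->
    cball (f u) (r / 8) (f y).
  by move=> ur yr; apply: le_trans; exact: lip.
have ball_sq y : norm2 y = r -> cball (f (f y)) (r / 8) = cball y (r / 8).
  by move=> yr; apply: cball_center; exact: sq.
pose V := cball x (r / 8) `|` cball (f x) (r / 8).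
have fxr := fS _ xr.
have sub1 : cball x (r / 8) `<=` sphere r by exact: cball_sphere.
have sub2 : cball (f x) (r / 8) `<=` sphere r by exact: cball_sphere.
have m1 := closed_measurable_borelQ2 _ (closed_cball2 x _ r8).
have m2 := closed_measurable_borelQ2 _ (closed_cball2 (f x) _ r8).
have algV : closed_algebra (sphere r) V.
  apply: sub_gen_smallest; split; last by move=> y [/sub1|/sub2].
  by apply: closedU; exact: closed_cball2.
have fV y : V y -> V (f y).
  move=> [yx|yx].
    by right; apply: ball_lip => //; exact: sub1.
  by left; rewrite -ball_sq//; apply: ball_lip => //; exact: sub2.
have inv : sphere r `&` f @^-1` V = V.
  apply/seteqP; split => y; last first.
    by move=> Vy; split; [case: Vy => [/sub1|/sub2]|exact: fV].
  (* If [f y] lies in [V], so does [f (f y)], which shares its ball with [y]. *)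
  move=> [yr /fV].
  have yE : cball (f (f y)) (r / 8) y by rewrite ball_sq// /cball/= subrr norm2_0 ltW.
  by move=> [h|h]; [left|right]; rewrite -(cball_center _ _ _ h).
(* The two balls may coincide, so the measure is only bounded on both sides. *)
have ge : ((4^-1)%:E <= mu V)%E.
  rewrite -(mu_ball x)//; apply: le_measure; rewrite ?inE.
  - exact: m1.
  - exact: (measurableU _ _ m1 m2).
  - by move=> y; left.
have le : (mu V <= (2^-1)%:E)%E.
  have := measureU2 mu m1 m2; rewrite [X in (_ <= X + _)%E](mu_ball x)//.
  rewrite [X in (_ <= _ + X)%E](mu_ball (f x))// => /le_trans; apply.
  by rewrite -EFinD lee_fin; lra.
case: (erg V algV inv) => muV; move: ge le; rewrite muV {muV} !lee_fin; lra.
Qed.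
End dynamics.

(** * The integers of [Q2] and the divided difference modulo 4 *)

Definition Z2 : {pred Q2} := fun x => norm2 x <= 1.

Lemma Z2_subring : subring_closed Z2.
Proof.
split=> [|x y|x y]; rewrite !unfold_in ?norm2_1 // => x1 y1.
  exact: norm2B_le.
by rewrite norm2M mulr_ile1 ?norm2_ge0.
Qed.

(** The subring structure lets the [rpred] lemmas certify that the cofactors of 4 in the congruences
    below are integral. *)
HB.instance Definition _ := GRing.isSubringClosed.Build Q2 Z2 Z2_subring.

Lemma Z2_half (x : Q2) : norm2 x <= 1 / 2 -> exists2 y, y \in Z2 & x = 2 * y.
Proof.
move=> x1; exists (x / 2); last by rewrite mulrCA divff ?mulr1// Q2_2_neq0.
by rewrite unfold_in norm2M norm2V norm2_2; lra.
Qed.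

Lemma norm2_4M (x : Q2) : x \in Z2 -> norm2 (4 * x) <= 1 / 4.
Proof.
move=> x1; have -> : 4 = 2 * 2 :> Q2 by rewrite -natrM.
rewrite !norm2M norm2_2.
by move: x1; rewrite unfold_in; lra.
Qed.

Lemma norm2_add1 (t : Q2) : norm2 t = 1 -> norm2 (t + 1) <= 1 / 2.
Proof.
move=> t1; have := norm2_residue t (- 1); rewrite norm2N norm2_1 opprK.
exact.
Qed.

(* With [A = a x / b], [D = d x / b], [B = x^2 / b] and [y = t x], the divided
   difference of [f] at [x] and [y] is the first term divided by the factor of
   [1 - B]. *)
Lemma slope_mod4_inner (A D B t : Q2) : norm2 A <= 1 / 2 -> norm2 D <= 1 / 2 ->
  norm2 B <= 1 / 2 -> norm2 t = 1 ->
  norm2 (((A * D - B) * t + A * (1 + t) + 1)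
    - (1 - B) * ((1 + D + B) * (1 + D * t + B * t ^+ 2))) <= 1 / 4.
Proof.
move=> /Z2_half[A' hA ->] /Z2_half[D' hD ->] /Z2_half[B' hB ->] t1.
have /Z2_half[s hs E] := norm2_add1 _ t1.
have {E}-> : t = 2 * s - 1 by rewrite -E addrK.
set t' := 2 * s - 1.
have ht' : t' \in Z2 by rewrite rpredB ?rpredM ?rpred1 ?rpred_nat.
(* With [D = 2 D'], [B = 2 B'] and [1 + t' = 2 s], the product of the two factors carrying [D] and
   [B] is [1 + 2 n]. *)
pose n := 2 * D' * s + B' * (1 + t' ^+ 2) + 2 * (D' + B') * (D' * t' + B' * t' ^+ 2).
rewrite (_ : _ - _ = 4 * (A' * D' * t' + (A' - D') * s
   - (D' + B') * (D' * t' + B' * t' ^+ 2) + B' * n - B' * t' * s)); last first.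
  by rewrite /n /t'; ring.
apply: norm2_4M.
by rewrite /n !(rpredD, rpredN, rpredM, rpredX, rpred1, rpred_nat).
Qed.

(* The same with [G = a / d], [E = b / (d x)] and [F = x / d]. *)
Lemma slope_mod4_middle (G E F t : Q2) : norm2 G <= 1 -> norm2 E <= 1 / 2 ->
  norm2 F <= 1 / 2 -> norm2 t = 1 ->
  norm2 (((G - E * F) * t + G * E * (1 + t) + E ^+ 2)
    - G * ((1 + F + E) * (t + F * t ^+ 2 + E))) <= 1 / 4.
Proof.
move=> hG /Z2_half[E' hE ->] /Z2_half[F' hF ->] t1.
have {}hG : G \in Z2 by [].
have /Z2_half[s hs Et] := norm2_add1 _ t1.
have {Et}-> : t = 2 * s - 1 by rewrite -Et addrK.
set t' := 2 * s - 1.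
have ht' : t' \in Z2 by rewrite rpredB ?rpredM ?rpred1 ?rpred_nat.
rewrite (_ : _ - _ = 4 * (- (E' * F' * t') + E' ^+ 2 - G * F' * t' * s
   - G * (F' + E') * (F' * t' ^+ 2 + E'))); last by rewrite /t'; ring.
apply: norm2_4M.
by rewrite !(rpredD, rpredN, rpredM, rpredX, rpred1, rpred_nat).
Qed.

(** Multipliers congruent modulo 4 are interchangeable; used to replace the computed multiplier by 1
    or -1. *)
Lemma slope_change (u v k e : Q2) : norm2 (u - k * v) <= norm2 v / 4 ->
  norm2 (k - e) <= 1 / 4 -> norm2 (u - e * v) <= norm2 v / 4.
Proof.
move=> h ke; have -> : u - e * v = (u - k * v) + (k - e) * v by ring.
apply: norm2D_le => //; rewrite norm2M mulrC.
by apply: le_trans (ler_wpM2l (norm2_ge0 _) ke) _; rewrite mul1r.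
Qed.

(** The numerator vanishes at the fixed points: doubly at 0 and simply at [a - d]. *)
Lemma fmap_move (K : fieldType) (a b d x : K) : x ^+ 2 + d * x + b != 0 ->
  (a * x ^+ 2 + b * x) / (x ^+ 2 + d * x + b) - x
  = x ^+ 2 * (a - d - x) / (x ^+ 2 + d * x + b).
Proof. by move=> dx; field. Qed.

(** Links the factors in the congruence to the denominators of [f] at [x] and [y], each scaled by
    the dominant term [b]. *)
Lemma inner_den (K : fieldType) (b d x y : K) : b != 0 -> x != 0 ->
  (1 + d * x / b + x ^+ 2 / b) *
    (1 + d * x / b * (y / x) + x ^+ 2 / b * (y / x) ^+ 2)
  = (x ^+ 2 + d * x + b) * (y ^+ 2 + d * y + b) / b ^+ 2.
Proof. by move=> b0 x0; field; rewrite b0 x0. Qed.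

Lemma inner_divided_difference (K : fieldType) (a b d x y k : K) :
  b != 0 -> x != 0 -> x ^+ 2 + d * x + b != 0 -> y ^+ 2 + d * y + b != 0 ->
  let den := (x ^+ 2 + d * x + b) * (y ^+ 2 + d * y + b) / b ^+ 2 in
  (a * y ^+ 2 + b * y) / (y ^+ 2 + d * y + b)
    - (a * x ^+ 2 + b * x) / (x ^+ 2 + d * x + b) - k * (y - x)
  = (y - x) * (((a * x / b * (d * x / b) - x ^+ 2 / b) * (y / x)
      + a * x / b * (1 + y / x) + 1 - k * den) / den).
Proof. by move=> b0 x0 dx dy; field; rewrite b0 x0 dx dy. Qed.

(** Here both denominators are scaled by the same [d * x], so the dominant term of the second factor
    is the unit [y / x] rather than 1. *)
Lemma middle_den (K : fieldType) (b d x y : K) : d != 0 -> x != 0 ->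
  (1 + x / d + b / (d * x)) *
    (y / x + x / d * (y / x) ^+ 2 + b / (d * x))
  = (x ^+ 2 + d * x + b) * (y ^+ 2 + d * y + b) / (d * x) ^+ 2.
Proof. by move=> b0 x0; field; rewrite b0 x0. Qed.

Lemma middle_divided_difference (K : fieldType) (a b d x y k : K) :
  d != 0 -> x != 0 -> x ^+ 2 + d * x + b != 0 -> y ^+ 2 + d * y + b != 0 ->
  let den := (x ^+ 2 + d * x + b) * (y ^+ 2 + d * y + b) / (d * x) ^+ 2 in
  (a * y ^+ 2 + b * y) / (y ^+ 2 + d * y + b)
    - (a * x ^+ 2 + b * x) / (x ^+ 2 + d * x + b) - k * (y - x)
  = (y - x) * (((a / d - b / (d * x) * (x / d)) * (y / x)
      + a / d * (b / (d * x)) * (1 + y / x) + (b / (d * x)) ^+ 2 - k * den) / den).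
Proof. by move=> b0 x0 dx dy; field; rewrite b0 x0 dx dy. Qed.

(** * Two ways in which ergodicity fails *)

Section not_ergodic.
Variables (R : realType) (mu : probability borelQ2 R) (r : rat) (f : Q2 -> Q2).
Hypothesis vr : norm_value r.
Hypothesis hmu : haar_sphere r mu.
Hypothesis fS : forall x, norm2 x = r -> norm2 (f x) = r.

(** [f (f x) - x] is [2 * (f x - x)], of norm at most [r / 8], plus an error of norm at most
    [r / 16]. *)
Lemma not_ergodic_of_small_move :
  (forall x y, norm2 x = r -> norm2 y = r ->
    norm2 (f y - f x - (y - x)) <= norm2 (y - x) / 4) ->
  (forall x, norm2 x = r -> norm2 (f x - x) <= r / 4) ->
  ~ ergodic (sphere r) f mu.
Proof.
move=> slope small; apply: not_ergodic_of_square => // [x y xr yr|x xr].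
  rewrite -[f y - f x](subrK (y - x)) norm2D_le//.
  by apply: le_trans (slope _ _ xr yr) _; have := norm2_ge0 (y - x); lra.
have -> : f (f x) - x = (f (f x) - f x - (f x - x)) + 2 * (f x - x) by ring.
have := small _ xr; have := slope _ _ xr (fS _ xr).
have := norm2_ge0 (f x - x) => h1 h2 h3.
by apply: norm2D_le; rewrite ?norm2M ?norm2_2; lra.
Qed.

(** With multiplier -1 the second step undoes the first modulo 4: [f (f x) - x] has norm at most a
    quarter of that of [f x - x], which is at most [r / 2]. *)
Lemma not_ergodic_of_slopeN :
  (forall x y, norm2 x = r -> norm2 y = r ->
    norm2 (f y - f x + (y - x)) <= norm2 (y - x) / 4) ->
  ~ ergodic (sphere r) f mu.
Proof.
move=> slope; apply: not_ergodic_of_square => // [x y xr yr|x xr].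
  rewrite -[f y - f x](addrK (y - x)) norm2B_le//.
  by apply: le_trans (slope _ _ xr yr) _; have := norm2_ge0 (y - x); lra.
have := slope _ _ xr (fS _ xr); rewrite addrA subrK.
have := norm2_residue (f x) x; rewrite fS// xr => /(_ erefl); lra.
Qed.

End not_ergodic.

(** * Radii at which [b] dominates the denominator *)

Section inner.
Variables (R : realType) (mu : probability borelQ2 R) (r : rat) (a b d : Q2).
Hypothesis vr : norm_value r.
Hypothesis hmu : haar_sphere r mu.
Hypothesis hA : norm2 a * r < norm2 b.
Hypothesis hD : norm2 d * r < norm2 b.
Hypothesis hB : r ^+ 2 < norm2 b.
Local Notation f := (fmap2 a b d).

Let r0 : 0 < r. Proof. exact: norm_value_gt0. Qed.

Let nb0 : 0 < norm2 b. Proof. exact: le_lt_trans (sqr_ge0 r) hB. Qed.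

Let b0 : b != 0.
Proof. by apply/eqP => b0; move: nb0; rewrite b0 norm2_0 ltxx. Qed.

Let x0 x : norm2 x = r -> x != 0.
Proof. by move=> xr; apply/eqP => x0; move: r0; rewrite -xr x0 norm2_0 ltxx. Qed.

Let quo_half z : norm2 z < norm2 b -> norm2 (z / b) <= 1 / 2.
Proof.
move=> zb; apply: norm2_lt_half; first by exists 0.
by rewrite norm2M norm2V ltr_pdivrMr// mul1r.
Qed.

Let halfA x : norm2 x = r -> norm2 (a * x / b) <= 1 / 2.
Proof. by move=> xr; apply: quo_half; rewrite norm2M xr. Qed.

Let halfD x : norm2 x = r -> norm2 (d * x / b) <= 1 / 2.
Proof. by move=> xr; apply: quo_half; rewrite norm2M xr. Qed.

Let halfB x : norm2 x = r -> norm2 (x ^+ 2 / b) <= 1 / 2.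
Proof. by move=> xr; apply: quo_half; rewrite expr2 norm2M xr. Qed.

Let norm_den x : norm2 x = r -> norm2 (x ^+ 2 + d * x + b) = norm2 b.
Proof.
move=> xr; apply: norm2D_lt; apply: le_lt_trans (norm2D _ _) _.
by rewrite gt_max expr2 !norm2M xr hB hD.
Qed.

Let den0 x : norm2 x = r -> x ^+ 2 + d * x + b != 0.
Proof.
by move=> xr; apply/eqP => E; move: nb0; rewrite -(norm_den x)// E norm2_0 ltxx.
Qed.

Lemma inner_sphere x : norm2 x = r -> norm2 (f x) = r.
Proof.
move=> xr; rewrite /fmap2 norm2M norm2V norm_den//.
have -> : a * x ^+ 2 + b * x = (a * x + b) * x by ring.
rewrite norm2M norm2D_lt ?norm2M ?xr// mulrAC divff ?mul1r//.
by rewrite gt_eqF.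
Qed.

Lemma inner_move x : norm2 x = r ->
  norm2 (f x - x) = r ^+ 2 * norm2 (a - d - x) / norm2 b.
Proof.
move=> xr; rewrite -(norm_den x)// -norm2V.
have -> : r ^+ 2 = norm2 (x ^+ 2) by rewrite [in RHS]expr2 norm2M xr.
rewrite -!norm2M; congr (norm2 _).
by rewrite /fmap2 fmap_move// den0.
Qed.

Lemma inner_slope x y : norm2 x = r -> norm2 y = r ->
  norm2 (f y - f x - (1 - x ^+ 2 / b) * (y - x)) <= norm2 (y - x) / 4.
Proof.
move=> xr yr; have dx := den0 x xr; have dy := den0 y yr; have nx := x0 x xr.
pose t := y / x.
have t1 : norm2 t = 1 by rewrite norm2M norm2V xr yr divff// gt_eqF.
have := slope_mod4_inner _ _ _ _ (halfA _ xr) (halfD _ xr) (halfB _ xr) t1.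
set num := (X in norm2 (X - _)).
set den := (X in norm2 (num - _ * X)) => h.
have denE : den = (x ^+ 2 + d * x + b) * (y ^+ 2 + d * y + b) / b ^+ 2.
  exact: inner_den.
have nden : norm2 den = 1.
  rewrite denE !norm2M norm2V norm_den// norm_den// expr2 norm2M divff//.
  by rewrite mulf_neq0 ?gt_eqF.
have -> : f y - f x - (1 - x ^+ 2 / b) * (y - x)
  = (y - x) * ((num - (1 - x ^+ 2 / b) * den) / den).
  by rewrite denE; exact: inner_divided_difference.
rewrite norm2M ler_wpM2l ?norm2_ge0// norm2M norm2V nden invr1 mulr1.
by rewrite -[4^-1]mul1r.
Qed.

Lemma inner_slope1 x y : 4 * r ^+ 2 <= norm2 b -> norm2 x = r -> norm2 y = r ->
  norm2 (f y - f x - (y - x)) <= norm2 (y - x) / 4.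
Proof.
move=> rb xr yr; have := slope_change _ _ _ 1 (inner_slope _ _ xr yr).
rewrite (mul1r (y - x)); apply.
rewrite addrAC subrr add0r norm2N norm2M norm2V expr2 norm2M xr.
by rewrite ler_pdivrMr// -expr2; lra.
Qed.

(** Now [x ^+ 2 / b] has norm 1/2, as does 2, so it is congruent to 2 modulo 4 and the multiplier
    [1 - x ^+ 2 / b] to -1. *)
Lemma inner_slopeN x y : 2 * r ^+ 2 = norm2 b -> norm2 x = r -> norm2 y = r ->
  norm2 (f y - f x + (y - x)) <= norm2 (y - x) / 4.
Proof.
move=> rb xr yr; have := slope_change _ _ _ (-1) (inner_slope _ _ xr yr).
rewrite mulN1r (opprK (y - x)); apply.
have -> : 1 - x ^+ 2 / b - -1 = 2 - x ^+ 2 / b by ring.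
have E : norm2 (x ^+ 2 / b) = 1 / 2.
  rewrite norm2M norm2V expr2 norm2M xr -expr2 -rb; field.
  by rewrite gt_eqF.
have := norm2_residue 2 (x ^+ 2 / b); rewrite E norm2_2 => /(_ erefl).
by lra.
Qed.

Lemma inner_ergodic : 4 * r ^+ 2 <= norm2 b ->
  2 * (r * norm2 (a - d)) = norm2 b -> ergodic (sphere r) f mu.
Proof.
move=> rb adb; apply: ergodic_of_mod4 => //; last by case: hmu.
- exact: inner_sphere.
(* The two hypotheses give [2 * r <= norm2 (a - d)], so [x] does not affect the norm of
   [a - d - x]. *)
- move=> x xr; rewrite inner_move// norm2_sym norm2B_lt; last first.
    by rewrite xr; have := r0; nra.
  have n0 : norm2 (a - d) != 0.
    by apply/eqP => E; move: nb0; rewrite -adb E !mulr0 ltxx.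
  by rewrite -adb; field; rewrite n0 (gt_eqF r0).
- by move=> x y xr yr; exact: inner_slope1.
Qed.

(** The first condition says that the multiplier is 1 modulo 4, the second that every point moves by
    [r / 2]. *)
Lemma inner_ergodicP : ergodic (sphere r) f mu <->
  4 * r ^+ 2 <= norm2 b /\ 2 * (r * norm2 (a - d)) = norm2 b.
Proof.
split=> [erg|[]]; last exact: inner_ergodic.
have [x xr] := sphere_nonempty _ vr; rewrite /sphere/= in xr.
have small : 4 * r ^+ 2 <= norm2 b.
  (* If the bound fails, discreteness leaves only norm 1/2 for [x ^+ 2 / b], and the multiplier is
     -1. *)
  rewrite leNgt; apply/negP => big.
  apply: (not_ergodic_of_slopeN _ _ _ _ vr hmu inner_sphere) erg => y z yr zr.
  apply: inner_slopeN => //.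
  have := halfB _ xr; have := norm2_lt_half (x ^+ 2 / b) (1 / 2).
  rewrite norm2M norm2V expr2 norm2M xr -expr2 ltr_pdivrMr// !ler_pdivrMr//.
  have v2 : norm_value (1 / 2) by exists (- 1).
  move=> /(_ v2) h1 h2; apply/eqP; rewrite eq_le; apply/andP; split; first by lra.
  rewrite leNgt; apply/negP => h3; have : r ^+ 2 < 1 / 2 * norm2 b by lra.
  by move=> /h1; lra.
split=> //; apply: contrapT => ne.
apply: (not_ergodic_of_small_move _ _ _ _ vr hmu inner_sphere) erg.
  by move=> y z yr zr; exact: inner_slope1.
move=> y yr; rewrite inner_move// ler_pdivrMr//.
(* The ratio [r * norm2 (a - d) / norm2 b] is a norm at most 1/2; being different from 1/2, it is at
   most 1/4. *)
have : r * norm2 (a - d) <= norm2 b / 4.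
  have h : norm2 ((a - d) * x / b) <= 1 / 2.
    by rewrite mulrBl mulrBl; apply: norm2B_le; [exact: halfA|exact: halfD].
  have E : norm2 ((a - d) * x / b) = r * norm2 (a - d) / norm2 b.
    by rewrite !norm2M norm2V xr mulrC [r * _]mulrC mulrC.
  have lt : norm2 ((a - d) * x / b) < 1 / 2.
    rewrite lt_neqAle h andbT; apply/eqP; rewrite E => E2; apply: ne.
    have : r * norm2 (a - d) = 1 / 2 * norm2 b by rewrite -E2 divfK// gt_eqF.
    by lra.
  have v2 : norm_value (1 / 2) by exists (- 1).
  by have := norm2_lt_half _ _ v2 lt; rewrite E ler_pdivrMr//; lra.
have := norm2B (a - d) y; rewrite yr le_max => /orP[h1|h1] h2.
  have := r0; nra.
have := r0; nra.
Qed.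

End inner.

(** * Radii at which [d * x] dominates the denominator *)

Section middle.
Variables (R : realType) (mu : probability borelQ2 R) (r : rat) (a b d : Q2).
Hypothesis vr : norm_value r.
Hypothesis hmu : haar_sphere r mu.
Hypothesis had : norm2 a = norm2 d.
Hypothesis hE : norm2 b < norm2 d * r.
Hypothesis hF : r < norm2 d.
Hypothesis hr : r <> norm2 (a - d).
Local Notation f := (fmap2 a b d).

Let r0 : 0 < r. Proof. exact: norm_value_gt0. Qed.

Let nd0 : 0 < norm2 d. Proof. exact: lt_trans r0 hF. Qed.

Let d0 : d != 0.
Proof. by apply/eqP => d0; move: nd0; rewrite d0 norm2_0 ltxx. Qed.

Let x0 x : norm2 x = r -> x != 0.
Proof. by move=> xr; apply/eqP => x0; move: r0; rewrite -xr x0 norm2_0 ltxx. Qed.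

Let halfE x : norm2 x = r -> norm2 (b / (d * x)) <= 1 / 2.
Proof.
move=> xr; apply: norm2_lt_half; first by exists 0.
by rewrite norm2M norm2V norm2M xr ltr_pdivrMr ?mulr_gt0// mul1r.
Qed.

Let halfF x : norm2 x = r -> norm2 (x / d) <= 1 / 2.
Proof.
move=> xr; apply: norm2_lt_half; first by exists 0.
by rewrite norm2M norm2V xr ltr_pdivrMr// mul1r.
Qed.

Let norm_den x : norm2 x = r -> norm2 (x ^+ 2 + d * x + b) = norm2 d * r.
Proof.
move=> xr.
have E : norm2 (x ^+ 2 + d * x) = norm2 d * r.
  by rewrite norm2D_lt ?norm2M xr// ltr_pM2r.
by rewrite addrC norm2D_lt E.
Qed.

Let den0 x : norm2 x = r -> x ^+ 2 + d * x + b != 0.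
Proof.
move=> xr; apply/eqP => E; have := mulr_gt0 nd0 r0.
by rewrite -(norm_den x)// E norm2_0 ltxx.
Qed.

Lemma middle_sphere x : norm2 x = r -> norm2 (f x) = r.
Proof.
move=> xr; rewrite /fmap2 norm2M norm2V norm_den//.
have -> : a * x ^+ 2 + b * x = (b + a * x) * x by ring.
rewrite norm2M norm2D_lt !norm2M had xr// mulrAC divff ?mul1r//.
by rewrite mulf_neq0// gt_eqF.
Qed.

Lemma middle_move x : norm2 x = r ->
  norm2 (f x - x) = r * norm2 (a - d - x) / norm2 d.
Proof.
move=> xr; rewrite /fmap2 fmap_move ?den0// !norm2M norm2V norm_den// xr.
by field; rewrite (gt_eqF r0) (gt_eqF nd0).
Qed.

Lemma middle_slope x y : norm2 x = r -> norm2 y = r ->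
  norm2 (f y - f x - a / d * (y - x)) <= norm2 (y - x) / 4.
Proof.
move=> xr yr; have dx := den0 x xr; have dy := den0 y yr; have nx := x0 x xr.
pose t := y / x.
have t1 : norm2 t = 1 by rewrite norm2M norm2V xr yr divff// gt_eqF.
have G1 : norm2 (a / d) <= 1 by rewrite norm2M norm2V had divff// gt_eqF.
have := slope_mod4_middle _ _ _ _ G1 (halfE _ xr) (halfF _ xr) t1.
set num := (X in norm2 (X - _)).
set den := (X in norm2 (num - _ * X)) => h.
have denE : den = (x ^+ 2 + d * x + b) * (y ^+ 2 + d * y + b) / (d * x) ^+ 2.
  exact: middle_den.
have nden : norm2 den = 1.
  rewrite denE !norm2M norm2V norm_den// norm_den// expr2 !norm2M xr divff//.
  by rewrite !mulf_neq0 ?gt_eqF.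
have -> : f y - f x - a / d * (y - x) = (y - x) * ((num - a / d * den) / den).
  by rewrite denE; exact: middle_divided_difference.
rewrite norm2M ler_wpM2l ?norm2_ge0// norm2M norm2V nden invr1 mulr1.
by rewrite -[4^-1]mul1r.
Qed.

Let norm_G : norm2 (a / d - 1) = norm2 (a - d) / norm2 d.
Proof. by rewrite -norm2V -norm2M mulrBl divff. Qed.

(** Since [a] and [d] have equal norms, [norm2 (a - d)] is at most [norm2 d / 2]. Equality makes the
    multiplier [a / d] congruent to -1; otherwise it is 1 modulo 4 and the displacement decides. *)
Lemma middle_ergodicP : ergodic (sphere r) f mu <-> r = norm2 d / 2.
Proof.
have vd : norm_value (norm2 d) by exact: norm2_value.
have ad := norm2_residue _ _ had.
have [small|big] := ltP (norm2 (a - d)) (norm2 d / 2); last first.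
  have E : norm2 (a - d) = norm2 d / 2 by apply/eqP; rewrite eq_le ad big.
  (* In this case [r = norm2 d / 2] would be the excluded radius [norm2 (a - d)]. *)
  split=> [|rd]; last by case: hr; rewrite E.
  move=> erg; exfalso; move: erg.
  apply: (not_ergodic_of_slopeN _ _ _ _ vr hmu middle_sphere) => x y xr yr.
  have := slope_change _ _ _ (-1) (middle_slope _ _ xr yr).
  rewrite mulN1r (opprK (y - x)); apply.
  (* Both [a / d - 1] and [- 2] have norm 1/2, so they differ by at most 1/4. *)
  have -> : a / d - -1 = (a / d - 1) - (- 2) by ring.
  have E2 : norm2 (a / d - 1) = norm2 (- 2).
    by rewrite norm_G E norm2N norm2_2; field; rewrite gt_eqF.
  by have := norm2_residue _ _ E2; rewrite norm2N norm2_2; lra.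
have slope1 x y : norm2 x = r -> norm2 y = r ->
    norm2 (f y - f x - (y - x)) <= norm2 (y - x) / 4.
  move=> xr yr; have := slope_change _ _ _ 1 (middle_slope _ _ xr yr).
  rewrite (mul1r (y - x)); apply; rewrite norm_G ler_pdivrMr//.
  have := norm2_lt_half _ _ (norm_value_half _ vd) small; lra.
split=> [erg|rd].
  apply: contrapT => rd.
  apply: (not_ergodic_of_small_move _ _ _ _ vr hmu middle_sphere slope1) erg.
  move=> x xr; rewrite middle_move//.
  have rd2 : r <= norm2 d / 2 by exact: norm_value_lt.
  have rd4 : r <= norm2 d / 2 / 2.
    apply: norm_value_lt => //; first exact: norm_value_half.
    by rewrite lt_neqAle rd2 andbT; apply/eqP.
  have ad4 := norm2_lt_half _ _ (norm_value_half _ vd) small.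
  rewrite -mulrA ler_wpM2l ?ler_pdivrMr ?(ltW r0)//.
  by apply: norm2B_le; rewrite ?xr; lra.
apply: ergodic_of_mod4 => //; first exact: middle_sphere; last by case: hmu.
move=> x xr; rewrite middle_move// norm2B_lt xr; last by rewrite rd.
by rewrite rd; field; rewrite gt_eqF.
Qed.

End middle.

(** * Translation of the two criteria into the conditions on [alpha] and [beta] *)

Theorem theorem16 (R : realType) (a b d x1 x2 : Q2) (r : rat)
    (mu : probability borelQ2 R)
    (hab : a * b <> 0) (had : a <> d)
    (hfix : (a - d) ^+ 2 + d * (a - d) + b <> 0)
    (hroots : ('X^2 + d *: 'X + b%:P = ('X - x1%:P) * ('X - x2%:P) :> {poly Q2}))
    (hle : norm2 x1 <= norm2 x2)
    (hr : radii (norm2 a) (norm2 x1) (norm2 x2) r)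
    (hrad : r <> norm2 (a - d))
    (hmu : haar_sphere r mu) :
  let alpha := norm2 x1 in
  let beta := norm2 x2 in
  ergodic (sphere r) (fmap2 a b d) mu <->
  [\/ [/\ norm2 a < beta, norm2 d = beta & r = alpha / 2],
      norm2 a = beta /\ r = beta / 2
    | beta < norm2 a /\ r = alpha * beta / (2 * norm2 a)].
Proof.
move=> alpha beta.
(* Vieta's formulas, read off by evaluating the polynomial identity at 0 and at 1. *)
have bE : b = x1 * x2.
  have := congr1 (fun p : {poly Q2} => p.[0]) hroots.
  by rewrite !hornerE /= !expr0n/= ?mulr0 ?add0r ?sub0r mulrNN.
have dE : d = - (x1 + x2).
  have := congr1 (fun p : {poly Q2} => p.[1]) hroots.
  rewrite !hornerE /= ?expr1n ?mulr1 bE => E.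
  have -> : d = (1 + d + x1 * x2) - 1 - x1 * x2 by ring.
  by rewrite E; ring.
have /andP[a0 b0] : (a != 0) && (b != 0) by rewrite -negb_or -mulf_eq0; apply/eqP.
have [x10 x20] : x1 != 0 /\ x2 != 0.
  by move: b0; rewrite bE mulf_eq0 negb_or => /andP[].
have albe : alpha <= beta := hle.
have al0 : 0 < alpha by exact: norm2_gt0.
have be0 : 0 < beta by exact: norm2_gt0.
have na0 : 0 < norm2 a by exact: norm2_gt0.
have val : norm_value alpha by exact: norm2_value.
have vbe : norm_value beta by exact: norm2_value.
have nb : norm2 b = alpha * beta by rewrite bE norm2M.
have nd_le : norm2 d <= beta by rewrite dE norm2N norm2D_le.
have nd_lt : alpha < beta -> norm2 d = beta.
  by move=> lt; rewrite dE norm2N norm2D_lt.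
(* Roots of equal norm partly cancel in their sum, again by the two-element residue field. *)
have nd_eq : alpha = beta -> norm2 d <= beta / 2.
  move=> E; rewrite dE opprD norm2_residue ?norm2N//.
have [vr _] := hr; have r0 := norm_value_gt0 _ vr.
have nad_ge0 := norm2_ge0 (a - d).
(* The cases of [radii] reduce to two regimes: [d * x] dominates for [alpha < r < beta], and [b]
   dominates for [r < alpha]. *)
have [[nab /andP[ar rb]]|[ra nar]] : (norm2 a = beta /\ alpha < r < beta) \/
    (r < alpha /\ norm2 a * r < alpha * beta).
- have [_ [[nab /andP[_ ra]]|[nab [/andP[_ ra]|rab]]|[nab /andP[_ ra]]]] := hr.
  + by right; split => //; rewrite mulrC ltr_pM// ltW.
  + by right; rewrite nab [alpha * _]mulrC ltr_pM2l.
  + by left.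
  + right; rewrite mulrC -ltr_pdivlMr//; split => //; apply: lt_trans ra _.
    by rewrite ltr_pdivrMr// ltr_pM2l.
- have nd := nd_lt (lt_trans ar rb).
  rewrite (middle_ergodicP _ _ _ _ b _ vr hmu) ?nd ?nab ?nb//; last first.
    by rewrite [beta * _]mulrC ltr_pM2r.
  split=> [rE|[[]|[]//|[]]]; first by apply: Or32.
  + by rewrite ltxx.
  + by rewrite ltxx.
have rh := norm_value_lt _ _ vr val ra.
rewrite inner_ergodicP ?nb//; first last.
- by apply: (@lt_le_trans _ _ (alpha * alpha)); rewrite ?ler_pM2l// expr2 ltr_pM// ltW.
- apply: (@le_lt_trans _ _ (beta * r)); first by rewrite ler_pM2r.
  by rewrite mulrC ltr_pM2r.
have nad_max : norm2 (a - d) <= Num.max (norm2 a) (norm2 d) := norm2B a d.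
have nad_a : norm2 d < norm2 a -> norm2 (a - d) = norm2 a.
  by move=> lt; rewrite norm2_sym norm2B_lt.
split=> [[r4 rn]|].
  (* As [2 * r <= alpha], the product [2 * r * norm2 (a - d)] reaches [alpha * beta] only if both
     factors attain their bounds. *)
  have nE : norm2 (a - d) <= beta -> norm2 (a - d) = beta /\ r = alpha / 2.
    move=> nb1; have nE : norm2 (a - d) = beta.
      apply/eqP; rewrite eq_le nb1/= -(ler_pM2l al0) -rn mulrA ler_wpM2r//.
      by lra.
    split=> //; apply: (mulIf (lt0r_neq0 be0)); rewrite -{1}nE; lra.
  case: (ltgtP (norm2 a) beta) => nab.
  + have [|nE1 rE] := nE; first by apply: norm2B_le => //; exact: ltW.
    apply: Or31; split=> //; apply/eqP; rewrite eq_le nd_le/= -nE1.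
    by move: nad_max; rewrite le_max nE1 [beta <= norm2 a]leNgt nab.
  + apply: Or33; split=> //; rewrite -rn nad_a ?(le_lt_trans nd_le)//.
    by field; rewrite gt_eqF.
  + have [|nE1 rE] := nE; first by apply: norm2B_le; rewrite ?nab.
    apply: Or32; split=> //; have [lt|gt|eq] := ltgtP alpha beta.
    (* Distinct root norms would give [a] and [d] the same norm [beta], forcing [norm2 (a - d)]
       below [beta]. *)
    * have : norm2 (a - d) <= norm2 d / 2 by apply: norm2_residue; rewrite nab nd_lt.
      by rewrite nE1 nd_lt//; lra.
    * by move: albe; rewrite leNgt gt.
    * by rewrite rE eq.
move=> [[nab nd rE]|[nab rE]|[nab rE]].
- by rewrite norm2B_lt ?nd// rE; split; [nra|lra].
(* If [alpha < beta], then [alpha <= beta / 2 = r] by discreteness, against [r <= alpha / 2]. *)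
- have ab : alpha = beta.
    apply/eqP; rewrite eq_le albe/= leNgt; apply/negP => lt.
    by have := norm_value_lt _ _ val vbe lt; lra.
  rewrite nad_a; last by rewrite nab; have := nd_eq ab; lra.
  by rewrite nab rE ab; split; lra.
- rewrite nad_a ?(le_lt_trans nd_le)//.
  have rn : 2 * (r * norm2 a) = alpha * beta by rewrite rE; field; rewrite gt_eqF.
  by split=> //; rewrite -rn; nra.
Qed.
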